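(* Let $X$ and $Y$ be finite simple graphs on the same vertex set $V$, and let $S\subseteq V$ satisfy \[ E(X)\mathbin{\triangle}E(Y)\subseteq \binom{S}{2}. \] For either the standard or the PSD color-change rule, and for every leak set $L\subseteq V$ and every $B\subseteq V$: if $B$ forces $X$ with leak set $L$, then $B\cup S$ forces $Y$ with the same leak set $L$ (under the same rule). Consequently, for every integer $\ell$ with $0\le\ell\le|V|$, \[ \bigl|Z^+_{(\ell)}(X)-Z^+_{(\ell)}(Y)\bigr|\le |S| \qquad\text{and}\qquad \bigl|Z_{(\ell)}(X)-Z_{(\ell)}(Y)\bigr|\le |S| . \]
   Context: All graphs are finite and simple. $\triangle$ is symmetric difference and $\binom{S}{2}$ is the set of all 2-element subsets of $S$ (edges are viewed as 2-element sets of vertices). Color-change rules on a graph $X$ with current blue set $B$ (all other vertices white). PSD rule: if $C$ is the vertex set of a connected component of $X-B$, a blue vertex $x\in B$ may force $y\in C$ (turn $y$ blue) when $N_X(x)\cap C=\{y\}$. Standard rule: the same with $C$ replaced by the full white set $V(X)\setminus B$, i.e. $x\in B$ may force $y$ when $N_X(x)\setminus B=\{y\}$. Forces are applied one after another, with the blue set (and the white components) updated after each force. A leak is a vertex forbidden to perform a force. For a leak set $L\subseteq V(X)$, a set $B$ ''forces $X$ with leak set $L$'' if, starting from the initial blue set $B$, there is a sequence of legal forces, none performed by a vertex of $L$, after which all vertices are blue. A set is an $\ell$-leaky PSD forcing set (resp. $\ell$-leaky standard forcing set) of $X$ if it forces $X$ under the PSD rule (resp. standard rule) with leak set $L$ for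 every $L\subseteq V(X)$ with $|L|=\ell$. $Z^+_{(\ell)}(X)$ (resp. $Z_{(\ell)}(X)$) is the minimum size of such a set, where $0\le \ell\le |V(X)|$. *)

(* Defs.v *)
From mathcomp Require Import all_boot.

Set Implicit Arguments.
Unset Strict Implicit.
Unset Printing Implicit Defensive.

Record sgraph (V : finType) := SGraph {
  adj : rel V;
  adj_sym : symmetric adj;
  adj_irrefl : irreflexive adj }.

Section Graphs.
Variable V : finType.
Implicit Types (X : sgraph V) (A B C L S : {set V}).

Definition nbhd X (x : V) : {set V} := [set y | adj X x y].

Definition edge_set X : {set {set V}} :=
  [set e : {set V} | [exists x, exists y, (e == [set x; y]) && adj X x y]].

Definition two_subsets S : {set {set V}} :=
  [set e : {set V} | (e \subset S) && (#|e| == 2)].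

Definition adj_minus X B : rel V :=
  [rel x y | [&& x \notin B, y \notin B & adj X x y]].

(* Vertex sets of the connected components of X - B; [connect] is reflexive
   even at blue vertices, but only classes of white vertices are collected. *)
Definition white_components X B : {set {set V}} :=
  equivalence_partition (connect (adj_minus X B)) (~: B).

Inductive color_rule := Standard | PSD.

Definition may_force (r : color_rule) X B (x y : V) : bool :=
  (x \in B) &&
  match r with
  | Standard => nbhd X x :\: B == [set y]
  | PSD => [exists C in white_components X B, nbhd X x :&: C == [set y]]
  end.

Definition force_step (r : color_rule) X L : rel {set V} :=
  [rel B B' | [exists x, exists y,
     [&& x \notin L, may_force r X B x y & B' == y |: B]]].

(* A path for [force_step] is a chronological sequence of forces. *)
Definition forces (r : color_rule) X L B : bool :=
  connect (force_step r X L) B [set: V].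

Definition leaky_forcing_set (r : color_rule) (l : nat) X B : bool :=
  [forall L : {set V}, (#|L| == l) ==> forces r X L B].

(* The default [set: V] is itself a leaky forcing set, so this is the true
   minimum; see [leaky_number_min]. *)
Definition leaky_number (r : color_rule) (l : nat) X : nat :=
  #|[arg min_(B < [set: V] | leaky_forcing_set r l X B) #|B|]|.

Definition Zplus (l : nat) X : nat := leaky_number PSD l X.
Definition Zstd (l : nat) X : nat := leaky_number Standard l X.

Lemma leaky_forcing_setT r l X : leaky_forcing_set r l X [set: V].
Proof. by apply/forallP => L; apply/implyP => _; apply: connect0. Qed.

Lemma leaky_number_min r l X :
  (exists2 B, leaky_forcing_set r l X B & #|B| = leaky_number r l X) /\
  (forall B, leaky_forcing_set r l X B -> leaky_number r l X <= #|B|).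
Proof.
rewrite /leaky_number; case: arg_minnP => [|B PB minB].
  exact: leaky_forcing_setT.
by split=> //; exists B.
Qed.

End Graphs.

Definition symdiff (T : finType) (A B : {set T}) : {set T} :=
  (A :\: B) :|: (B :\: A).

(* Main.v *)
Require Import Defs.
From mathcomp Require Import all_boot all_order all_algebra.
Import GRing.Theory Num.Theory.

(** Run the forcing sequence of [X] in [Y] from any blue set containing [B] and
    [S], skipping the forces of vertices that are already blue. Once [S] is
    blue, [X] and [Y] have the same edges at every white vertex, so each white
    component of [Y] lies in a white component of [X] with fewer blue vertices,
    and the force that is legal in [X] is legal in [Y]. *)

Lemma mem_edge_set (V : finType) (X : sgraph V) (x y : V) :
  ([set x; y] \in edge_set X) = adj X x y.
Proof.
rewrite inE; apply/existsP/idP => [[a /existsP[b /andP[/eqP eq_e ab]]]|xy].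
  (* If [x = y], the pair collapses to a singleton, whereas an edge [[set a; b]] has two elements by
     irreflexivity. *)
  have neq_xy : x != y.
    apply/eqP => eq_xy; move: (cards2 a b).
    rewrite -eq_e eq_xy setUid cards1.
    by case: eqP ab => // ->; rewrite adj_irrefl.
  move: (set21 x y) (set22 x y) neq_xy.
  rewrite eq_e => /set2P[]-> /set2P[]->; rewrite ?eqxx // => _.
  by rewrite adj_sym.
by exists x; apply/existsP; exists y; rewrite eqxx.
Qed.

Lemma symdiffC (T : finType) (A B : {set T}) : symdiff A B = symdiff B A.
Proof. exact: setUC. Qed.

(** A pair on which the graphs differ has both ends in [S], so a single end outside [S] already
    rules it out. *)
Lemma adj_eq_off (V : finType) (X Y : sgraph V) (S : {set V}) (x y : V) :
  symdiff (edge_set X) (edge_set Y) \subset two_subsets S ->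
  y \notin S -> adj X x y = adj Y x y.
Proof.
move=> /subsetP/(_ [set x; y]) sXY yNS.
have: [set x; y] \notin symdiff (edge_set X) (edge_set Y).
  apply: contra yNS => /sXY; rewrite inE => /andP[/subsetP sS _].
  by apply: sS; rewrite set22.
by rewrite !(in_setU, in_setD) !mem_edge_set; do 2 case: (adj _ x y).
Qed.

Lemma may_force_transfer (V : finType) (r : color_rule) (X Y : sgraph V)
    (S B D : {set V}) (x y : V) :
  symdiff (edge_set X) (edge_set Y) \subset two_subsets S ->
  B \subset D -> S \subset D -> y \notin D ->
  may_force r X B x y -> may_force r Y D x y.
Proof.
move=> hS sBD sSD yND /andP[xB forceX].
have eq_adj u v : v \notin D -> adj Y u v = adj X u v.
  move=> vND; apply/esym; apply: adj_eq_off hS _.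
  by apply: contra vND; apply: (subsetP sSD).
have notinB v : v \notin D -> v \notin B.
  by apply: contra; apply: (subsetP sBD).
rewrite /may_force (subsetP sBD) //=; case: r forceX => [/eqP|].
  move/setP=> NX; apply/eqP/setP=> z; have := NX z.
  rewrite !inE; have [zD _ | zND] := boolP (z \in D).
    by apply/esym/eqP => eq_zy; rewrite -eq_zy zD in yND.
  by rewrite (negPf (notinB _ zND)) eq_adj.
case/existsP=> _ /andP[/imsetP[c _ ->] /eqP/setP NX].
have /andP[xy /andP[_ cy]] :
    adj X x y && ((y \notin B) && connect (adj_minus X B) c y).
  by have := NX y; rewrite !inE eqxx.
(* Here [c] represents the white component of [X] used by the force. It contains [y], and every edge
   of [Y - D] is an edge of [X - B]. *)
have sub_connect z :
    connect (adj_minus Y D) y z -> connect (adj_minus X B) c z.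
  move=> yz; apply: connect_trans cy _; apply: connect_sub yz => u v.
  case/and3P=> uND vND; rewrite eq_adj // => uv.
  by apply/connect1/and3P; split=> //; apply: notinB.
apply/existsP.
(* The witness is the component of [y] in [Y - D]. *)
exists [set z in ~: D | connect (adj_minus Y D) y z]; apply/andP; split.
  by apply/imsetP; exists y; rewrite // inE.
apply/eqP/setP=> z; rewrite !inE.
have [-> | neq_zy] := eqVneq z y.
  by rewrite eq_adj // xy yND connect0.
(* A second neighbour [z] of [x] in this component would also lie in the component of [c], where [y]
   is the only neighbour of [x] in [X]. *)
apply/negP=> /and3P[xz zND /sub_connect cz]; have := NX z.
by rewrite !inE (negPf neq_zy) -eq_adj // xz notinB //= cz.
Qed.

(** An arbitrary [D] above [B] and [S] gives an invariant that survives each step: [B] always gains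
    [y], while [D] gains it only if still white there. *)
Lemma forces_transfer (V : finType) (r : color_rule) (X Y : sgraph V)
    (S L B D : {set V}) :
  symdiff (edge_set X) (edge_set Y) \subset two_subsets S ->
  B \subset D -> S \subset D -> forces r X L B -> forces r Y L D.
Proof.
move=> hS sBD sSD /connectP[p].
elim: p B D sBD sSD => [|B' p IHp] B D sBD sSD /=.
  move=> _ eqB; move: sBD; rewrite -eqB subTset => /eqP->.
  exact: connect0.
case/andP=> /existsP[x /existsP[y /and3P[xNL Fxy /eqP->]]] path_p last_p.
have [yD | yND] := boolP (y \in D).
  by apply: IHp path_p last_p; rewrite // subUset sub1set yD.
apply: (@connect_trans _ _ (y |: D)).
  apply/connect1/existsP; exists x; apply/existsP; exists y.
  by rewrite xNL eqxx andbT; apply: may_force_transfer hS sBD sSD yND Fxy.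
by apply: IHp path_p last_p; [apply: setUS | apply: subsetU; rewrite sSD orbT].
Qed.

(** The transfer keeps the leak set fixed, so adding [S] to one minimum set for [X] handles all leak
    sets of size [l] in [Y] at once. *)
Lemma leaky_number_leq (V : finType) (r : color_rule) (l : nat)
    (X Y : sgraph V) (S : {set V}) :
  symdiff (edge_set X) (edge_set Y) \subset two_subsets S ->
  leaky_number r l Y <= leaky_number r l X + #|S|.
Proof.
move=> hS; have [[B /forallP FB <-] _] := leaky_number_min r l X.
apply: (@leq_trans #|B :|: S|); last exact: leq_card_setU.
apply: (leaky_number_min r l Y).2; apply/forallP=> L; apply/implyP=> cardL.
apply: forces_transfer hS (subsetUl B S) (subsetUr B S) _.
exact: implyP (FB L) cardL.
Qed.

Lemma leaky_number_dist (V : finType) (r : color_rule) (l : nat)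
    (X Y : sgraph V) (S : {set V}) :
  symdiff (edge_set X) (edge_set Y) \subset two_subsets S ->
  (`|(leaky_number r l X)%:Z - (leaky_number r l Y)%:Z| <= #|S|%:Z)%R.
Proof.
(* The hypothesis is symmetric in [X] and [Y], which gives both one-sided bounds. *)
move=> hS; have hS' := hS; rewrite symdiffC in hS'.
have := leaky_number_leq _ r l _ _ _ hS; have := leaky_number_leq _ r l _ _ _ hS'.
move: (leaky_number r l X) (leaky_number r l Y) #|S| => a b s le_ab le_ba.
by rewrite ler_distlC lerBlDr -!PoszD !lez_nat le_ab le_ba.
Qed.

Theorem theorem3 (V : finType) (X Y : sgraph V) (S : {set V})
  (hS : symdiff (edge_set X) (edge_set Y) \subset two_subsets S) :
  (forall (r : color_rule) (L B : {set V}),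
     forces r X L B -> forces r Y L (B :|: S)) /\
  (forall l : nat, (l <= #|V|)%N ->
     (`|(Zplus l X)%:Z - (Zplus l Y)%:Z| <= #|S|%:Z)%R /\
     (`|(Zstd l X)%:Z - (Zstd l Y)%:Z| <= #|S|%:Z)%R).
Proof.
split=> [r L B | l _]; last by split; apply: leaky_number_dist.
exact: forces_transfer hS (subsetUl B S) (subsetUr B S).
Qed.
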